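(* Let $V$ be a $\mathbb{Z}$-graded vector space. (1) Suppose that $(V,\{\hat{\mathfrak m}_n\})$ is an $A_\infty$-algebra. Then $(V,\{\hat\gamma(\hat{\mathfrak m}_n)\})$ is a $PL_\infty$-algebra, where $$\hat\gamma(\hat{\mathfrak m}_n)(x_1,\dots,x_n)=\sum_{\sigma\in\mathbb{S}_{n-1}}\epsilon(\sigma)\,\hat{\mathfrak m}_n(x_{\sigma(1)},\dots,x_{\sigma(n-1)},x_n).$$ (2) For a $PL_\infty$-algebra $(V,\{\hat{\mathfrak p}_n\})$, the collection $\{\hat\beta(\hat{\mathfrak p}_n)\}$ defines an $L_\infty$-algebra structure on $V$, where $$\hat\beta(\hat{\mathfrak p}_n)(x_1,\dots,x_n)=\sum_{\sigma\in Sh(n-1,1)}\epsilon(\sigma)\,\hat{\mathfrak p}_n(x_{\sigma(1)},\dots,x_{\sigma(n-1)},x_{\sigma(n)}).$$ (Here $x_1,\dots,x_n$ are homogeneous elements of $V$, and all homotopy algebras are in the degree $-1$ version given in the context.)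
   Context: All vector spaces are over a field $\mathbb{K}$ of characteristic $0$. For a graded space $V=\oplus_{n\in\mathbb{Z}}V^n$, $|x|$ is the degree of a homogeneous $x$; a linear map $f$ is homogeneous of degree $d$, $|f|=d$, if $f(V^i)\subseteq W^{i+d}$. Tensor products of homogeneous maps: $(f\otimes g)(x\otimes y)=(-1)^{|x||g|}f(x)\otimes g(y)$. $I_n$ is the identity of $\otimes^nV$. In sums $\sum_{i+j=n+1}$, $i,j\ge1$. Koszul sign: $\epsilon(\sigma)=\epsilon(\sigma;x_1,\dots,x_n)\in\{\pm1\}$ is determined by $x_1\wedge\cdots\wedge x_n=\epsilon(\sigma)\,x_{\sigma(1)}\wedge\cdots\wedge x_{\sigma(n)}$, where $\wedge$ is graded commutative: $x\wedge y=(-1)^{|x||y|}y\wedge x$. For $\sigma\in\mathbb{S}_n$: $\rho^{(1)}_\sigma(x_1\otimes\cdots\otimes x_n)=\epsilon(\sigma)x_{\sigma(1)}\otimes\cdots\otimes x_{\sigma(n)}$, extended linearly to $\mathbb{K}\mathbb{S}_n$; $w_n=\sum_{\sigma\in\mathbb{S}_n}\sigma$. $Sh(n-1,1)$ is the set of $\sigma\in\mathbb{S}_n$ with $\sigma(1)<\cdots<\sigma(n-1)$. A graded vector space $V$ with homogeneous linear maps $\hat\mu_n:\otimes^nV\to V$, $n\ge1$, of degree $-1$ is: - an $A_\infty$-algebra if for all $n\ge1$, $\sum_{i+j=n+1}\sum_{m=0}^{i-1}\hat\mu_i\circ(I_m\otimes\hat\mu_j\otimes I_{i-m-1})=0$;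 - a $PL_\infty$-algebra if for all $n\ge1$, $\hat\mu_n=\hat\mu_n\circ(\rho^{(1)}_\sigma\otimes I_1)$ for all $\sigma\in\mathbb{S}_{n-1}$, and $\sum_{i+j=n+1}\sum_{m=0}^{i-1}\frac{1}{(i-1)!(j-1)!}\hat\mu_i\circ(I_m\otimes\hat\mu_j\otimes I_{i-m-1})\circ(\rho^{(1)}_{w_{i+j-2}}\otimes I_1)=0$; - an $L_\infty$-algebra if for all $n\ge1$, $\hat\mu_n=\hat\mu_n\circ\rho^{(1)}_\sigma$ for all $\sigma\in\mathbb{S}_n$, and $\sum_{i+j=n+1}\sum_{m=0}^{i-1}\frac{1}{i!\,j!}\hat\mu_i\circ(I_m\otimes\hat\mu_j\otimes I_{i-m-1})\circ\rho^{(1)}_{w_{i+j-1}}=0$. *)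

(* Defs.v *)
From HB Require Import structures.
From mathcomp Require Import all_boot all_order all_fingroup all_algebra.
From mathcomp Require Import boolp classical_sets functions cardinality fsbigop.

Set Implicit Arguments.
Unset Strict Implicit.
Unset Printing Implicit Defensive.

Import Order.TTheory GRing.Theory Num.Theory.
Local Open Scope classical_set_scope.
Local Open Scope ring_scope.

(* An internal direct sum decomposition V = (+)_(i : int) V^i into subspaces:
   every v is, in exactly one way, a finite sum of elements v_i of V^i. *)
Record grading (K : fieldType) (V : lmodType K) := Grading {
  piece :> int -> set V;
  piece0 : forall i, piece i 0;
  piece_lin : forall i (a : K) (u v : V),
    piece i u -> piece i v -> piece i (a *: u + v);
  piece_direct : forall v : V, exists! c : int -> V,
    [/\ forall i, piece i (c i),
        finite_set [set i | c i != 0]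
      & v = \sum_(i \in [set: int]) c i]
}.

Definition component (K : fieldType) (V : lmodType K) (G : grading V)
    (i : int) (v : V) : V :=
  sval (cid (piece_direct G v)) i.

Definition homogeneous (K : fieldType) (V : lmodType K) (G : grading V)
    (n : nat) (d : n.-tuple int) (x : n.-tuple V) : Prop :=
  forall k : 'I_n, G (tnth d k) (tnth x k).

(* (t_0, ..., t_(n-1)) |-> (t_(s 0), ..., t_(s (n-1))). *)
Definition permute (T : Type) (n : nat) (s : 'S_n) (t : n.-tuple T) :
    n.-tuple T :=
  [tuple tnth t (s k) | k < n].

(* s : 'S_n extended to a permutation of n.+1 letters fixing the last one. *)
Definition fix_last (n : nat) (s : 'S_n) : 'S_n.+1 :=
  lift_perm ord_max ord_max s.

Definition drop_last (T : Type) (n : nat) (t : n.+1.-tuple T) : n.-tuple T :=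
  [tuple tnth t (lift ord_max k) | k < n].

(* The Koszul sign of s on elements of degrees d: each inversion of s
   contributes the sign of exchanging the two elements involved.  Lemma
   koszulP is the defining relation
   x_1 ... x_n = epsilon(s) x_s(1) ... x_s(n) for graded commuting x_i. *)
Definition koszul (K : fieldType) (n : nat) (s : 'S_n) (d : n.-tuple int) : K :=
  \prod_(k < n) \prod_(l < n | (k < l)%N && (s l < s k)%N)
     (-1) ^ (tnth d (s k) * tnth d (s l)).

Lemma koszulP (K : fieldType) (A : algType K) (n : nat) (d : n.-tuple int)
    (x : 'I_n -> A)
    (graded_comm : forall k l : 'I_n,
       x k * x l = ((-1 : K) ^ (tnth d k * tnth d l)) *: (x l * x k))
    (s : 'S_n) :
  \prod_(k < n) x k = koszul K s d *: \prod_(k < n) x (s k).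
Proof.
pose c (k l : 'I_n) : K := (-1) ^ (tnth d k * tnth d l).
pose below (k l : 'I_n) := (k < l)%N.
pose sgn := fix sgn (r : seq 'I_n) : K := if r is a :: r' then
  (\prod_(b <- r' | below b a) c a b) * sgn r' else 1.
have moveP a r : (\prod_(b <- r) x b) * x a =
    (\prod_(b <- r) c a b) *: (x a * \prod_(b <- r) x b).
  elim: r => [|b r IHr]; first by rewrite !big_nil mul1r mulr1 scale1r.
  rewrite !big_cons -mulrA IHr -scalerAr [x b * (_ * _)]mulrA [x b * x a]graded_comm -scalerAl scalerA.
  by rewrite -mulrA [X in X *: _]mulrC /c [tnth d b * _]mulrC.
have sgnP r t : pairwise below t -> perm_eq r t ->
    \prod_(a <- t) x a = sgn r *: \prod_(a <- r) x a.
  elim: r t => [|a r IHr] t tlt; rewrite perm_sym => rt.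
    by rewrite (perm_nilP rt) !big_nil scale1r.
  have : a \in t by rewrite (perm_mem rt) mem_head.
  move=> /path.splitPr at_t; case: at_t tlt rt => t1 t2.
  rewrite pairwise_cat allrel_consr pairwise_cons.
  move=> /and4P[/andP[t1a t12] t1lt at2 t2lt].
  rewrite -cat1s perm_catCA /= perm_cons => rt.
  have := IHr (t1 ++ t2); rewrite pairwise_cat t12 t1lt t2lt perm_sym.
  move=> /(_ isT rt) IH.
  rewrite big_cat big_cons /= mulrA moveP -scalerAl -mulrA big_cons.
  rewrite -big_cat IH -scalerAr scalerA; congr (_ * _ *: _).
  rewrite -(perm_big _ rt) big_cat /= [X in _ = _ * X]big1_seq ?mulr1; last first.
    by move=> b /andP[ba bt2]; move: ba (allP at2 _ bt2); rewrite /below; case: ltngtP.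
  rewrite [RHS]big_mkcond /=; apply: eq_big_seq => b /(allP t1a).
  by rewrite /below => ->.
have sgn_map t : pairwise below t ->
    sgn [seq s k | k <- t] =
    \prod_(k <- t) \prod_(l <- t | (k < l)%N && (s l < s k)%N) c (s k) (s l).
  elim: t => [|k t IHt]; first by rewrite big_nil.
  rewrite pairwise_cons => /andP[/allP kt tlt] /=.
  rewrite IHt // big_map !big_cons ltnn /=; congr (_ * _).
    rewrite big_mkcond [RHS]big_mkcond; apply: eq_big_seq => l /kt.
    by rewrite /below => ->.
  apply: eq_big_seq => l /kt kl; rewrite big_cons ltnNge (ltnW kl) //.
have enum_lt : pairwise below (enum 'I_n).
  rewrite -(@pairwise_map _ _ val ltn) val_enum_ord.
  by rewrite -(sorted_pairwise ltn_trans) iota_ltn_sorted.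
have perm_s : perm_eq [seq s k | k <- enum 'I_n] (enum 'I_n).
  apply: uniq_perm; rewrite ?(map_inj_uniq perm_inj) ?enum_uniq //.
  move=> k; rewrite mem_enum; apply/mapP; exists ((s^-1)%g k).
    by rewrite mem_enum.
  by rewrite permKV.
have enumE : index_enum 'I_n = enum 'I_n by rewrite [LHS]unlock enumT.
rewrite /koszul enumE (sgnP _ _ enum_lt perm_s) sgn_map //.
by rewrite [X in _ *: X = _]big_map.
Qed.

(* Linear maps (x)^n V -> V are represented by n-linear maps on V. *)
Definition multilinear (K : fieldType) (V : lmodType K) (n : nat)
    (f : n.-tuple V -> V) : Prop :=
  forall (k : 'I_n) (x : n.-tuple V) (a : K) (u v : V),
    let put w := [tuple if l == k then w else tnth x l | l < n] in
    f (put (a *: u + v)) = a *: f (put u) + f (put v).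

Lemma multilinear_eq0 (K : fieldType) (V : lmodType K) (n : nat)
    (f : n.-tuple V -> V) (x : n.-tuple V) (k : 'I_n) :
  multilinear f -> tnth x k = 0 -> f x = 0.
Proof.
move=> flin xk0; have := flin k x 1 0 0.
rewrite /= !scale1r addr0 -[LHS]addr0 => /addrI /esym.
congr (f _ = _); apply: eq_from_tnth => l.
by rewrite tnth_mktuple; case: eqP => // ->.
Qed.

Lemma permute_eq0 (K : fieldType) (V : lmodType K) (n : nat)
    (f : n.-tuple V -> V) (s : 'S_n) (x : n.-tuple V) (k : 'I_n) :
  multilinear f -> tnth x k = 0 -> f (permute s x) = 0.
Proof.
move=> flin xk0; apply: (multilinear_eq0 (k := (s^-1)%g k) flin).
by rewrite tnth_mktuple permKV.
Qed.

Definition has_degree (K : fieldType) (V : lmodType K) (G : grading V)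
    (e : int) (n : nat) (f : n.-tuple V -> V) : Prop :=
  forall (d : n.-tuple int) (x : n.-tuple V),
    homogeneous G d x -> G (\sum_(k < n) tnth d k + e) (f x).

(* The multilinear map whose value on x homogeneous of degrees d is F d x
   (see extendE), provided each F d is multilinear. *)
Definition extend (K : fieldType) (V : lmodType K) (G : grading V) (n : nat)
    (F : n.-tuple int -> n.-tuple V -> V) (x : n.-tuple V) : V :=
  \sum_(d \in [set: n.-tuple int])
     F d [tuple component G (tnth d k) (tnth x k) | k < n].

Lemma fsum_single (I : choiceType) (V : nmodType) (F : I -> V) (i : I) :
  (forall j, j <> i -> F j = 0) -> \sum_(j \in [set: I]) F j = F i.
Proof.
move=> F0; rewrite -(fsbig_widen [set i] setT) ?fsbig_set1//.
by move=> j [_] /= /F0.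
Qed.

Lemma component_homogeneous (K : fieldType) (V : lmodType K) (G : grading V)
    (i j : int) (v : V) :
  G i v -> component G j v = if j == i then v else 0.
Proof.
move=> Gv; rewrite /component; case: cid => c /= [_ /(_ (fun k => if k == i then v else 0))] -> //.
split=> [k||]; first by case: eqP => [->//|_]; exact: piece0.
- apply: (@sub_finite_set _ _ [set i]); last exact: finite_set1.
  by move=> k /=; case: (k =P i) => // _; rewrite eqxx.
- rewrite (@fsum_single _ _ _ i) ?eqxx// => k nki.
  by case: eqP => // /nki.
Qed.

Lemma extendE (K : fieldType) (V : lmodType K) (G : grading V) (n : nat)
    (F : n.-tuple int -> n.-tuple V -> V)
    (F0 : forall d x (k : 'I_n), tnth x k = 0 -> F d x = 0)
    (d : n.-tuple int) (x : n.-tuple V) :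
  homogeneous G d x -> extend G F x = F d x.
Proof.
move=> Gx; rewrite /extend.
have Fd (e : n.-tuple int) : e <> d ->
    F e [tuple component G (tnth e k) (tnth x k) | k < n] = 0.
  move=> ned; have [k nek] : exists k, tnth e k <> tnth d k.
    apply: contrapT => /forallNP eq_ed; apply: ned.
    by apply: eq_from_tnth => k; apply: contrapT; exact: eq_ed.
  apply: (F0 _ _ k); rewrite tnth_mktuple (component_homogeneous _ (Gx k)).
  by case: eqP => // /nek.
rewrite (fsum_single Fd).
congr F; apply: eq_from_tnth => k.
by rewrite tnth_mktuple (component_homogeneous _ (Gx k)) eqxx.
Qed.

(* mu n is the operation of arity n.+1, so that arities start at 1. *)
Definition operations (K : fieldType) (V : lmodType K) : Type :=
  forall n : nat, n.+1.-tuple V -> V.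

Definition operations_degN1 (K : fieldType) (V : lmodType K) (G : grading V)
    (mu : operations V) : Prop :=
  forall n, multilinear (mu n) /\ has_degree G (-1) (mu n).

(* f o (I_m (x) g (x) I_(p-m-1)) on a tensor x of homogeneous elements of
   degrees d, where g is of degree -1 and passes the first m elements of x:
   sign * f (x_0, .., x_(m-1), g (x_m, .., x_(m+q-1)), x_(m+q), ..).
   It is only used with m < p, 0 < q and x of size p + q - 1, so that the
   default values of nth are irrelevant. *)
Definition insert (K : fieldType) (V : lmodType K) (p q m : nat)
    (f : p.-tuple V -> V) (g : q.-tuple V -> V)
    (d : seq int) (x : seq V) : V :=
  ((-1 : K) ^ ((\sum_(0 <= k < m) d`_k) * -1)) *:
  f [tuple if (k < m)%N then x`_k
           else if k == m :> nat then g [tuple x`_(m + l)%N | l < q]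
           else x`_(k + q).-1%N | k < p].

(* In the three structures below, an identity between multilinear maps is
   stated on homogeneous elements.  The pair of arities (i.+1, j.+1) with
   i + j = n corresponds to the summation over arities adding up to n.+2,
   and the relation has arity n.+1. *)
Record A_infinity (K : fieldType) (V : lmodType K) (G : grading V)
    (mu : operations V) : Prop := {
  A_infinity_deg : operations_degN1 G mu;
  A_infinity_rel : forall n (d : n.+1.-tuple int) (x : n.+1.-tuple V),
    homogeneous G d x ->
    \sum_(i < n.+1) \sum_(m < i.+1) insert m (mu i) (mu (n - i)%N) d x = 0
}.

Record PL_infinity (K : fieldType) (V : lmodType K) (G : grading V)
    (mu : operations V) : Prop := {
  PL_infinity_deg : operations_degN1 G mu;
  PL_infinity_sym : forall n (s : 'S_n) (d : n.+1.-tuple int)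
      (x : n.+1.-tuple V),
    homogeneous G d x ->
    mu n x = koszul K s (drop_last d) *: mu n (permute (fix_last s) x);
  PL_infinity_rel : forall n (d : n.+1.-tuple int) (x : n.+1.-tuple V),
    homogeneous G d x ->
    \sum_(i < n.+1) \sum_(m < i.+1)
      ((i`! * (n - i)`!)%N%:R^-1 : K) *:
      (\sum_(s : 'S_n) koszul K s (drop_last d) *:
        insert m (mu i) (mu (n - i)%N)
          (permute (fix_last s) d) (permute (fix_last s) x)) = 0
}.

Record L_infinity (K : fieldType) (V : lmodType K) (G : grading V)
    (mu : operations V) : Prop := {
  L_infinity_deg : operations_degN1 G mu;
  L_infinity_sym : forall n (s : 'S_n.+1) (d : n.+1.-tuple int)
      (x : n.+1.-tuple V),
    homogeneous G d x -> mu n x = koszul K s d *: mu n (permute s x);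
  L_infinity_rel : forall n (d : n.+1.-tuple int) (x : n.+1.-tuple V),
    homogeneous G d x ->
    \sum_(i < n.+1) \sum_(m < i.+1)
      ((i.+1`! * (n - i).+1`!)%N%:R^-1 : K) *:
      (\sum_(s : 'S_n.+1) koszul K s d *:
        insert m (mu i) (mu (n - i)%N) (permute s d) (permute s x)) = 0
}.

Definition gamma_hat (K : fieldType) (V : lmodType K) (G : grading V)
    (mu : operations V) : operations V :=
  fun n => extend G (fun d x =>
    \sum_(s : 'S_n)
      koszul K s (drop_last d) *: mu n (permute (fix_last s) x)).

Lemma gamma_hatE (K : fieldType) (V : lmodType K) (G : grading V)
    (mu : operations V) (n : nat) (d : n.+1.-tuple int) (x : n.+1.-tuple V) :
  multilinear (mu n) -> homogeneous G d x ->
  gamma_hat G mu x =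
    \sum_(s : 'S_n) koszul K s (drop_last d) *: mu n (permute (fix_last s) x).
Proof.
move=> mulin; apply: extendE => {}d {}x k xk0; apply: big1 => s _.
by rewrite (permute_eq0 _ mulin xk0) scaler0.
Qed.

(* Sh(n, 1), a subset of the symmetric group on n.+1 letters. *)
Definition shuffle1 (n : nat) : {set 'S_n.+1} :=
  [set s : 'S_n.+1 | [forall k : 'I_n.+1, forall l : 'I_n.+1,
     (k < l < n)%N ==> (s k < s l)%N]].

Definition beta_hat (K : fieldType) (V : lmodType K) (G : grading V)
    (mu : operations V) : operations V :=
  fun n => extend G (fun d x =>
    \sum_(s in shuffle1 n) koszul K s d *: mu n (permute s x)).

Lemma beta_hatE (K : fieldType) (V : lmodType K) (G : grading V)
    (mu : operations V) (n : nat) (d : n.+1.-tuple int) (x : n.+1.-tuple V) :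
  multilinear (mu n) -> homogeneous G d x ->
  beta_hat G mu x =
    \sum_(s in shuffle1 n) koszul K s d *: mu n (permute s x).
Proof.
move=> mulin; apply: extendE => {}d {}x k xk0; apply: big1 => s _.
by rewrite (permute_eq0 _ mulin xk0) scaler0.
Qed.

(* Main.v *)
(* For a graded multilinear F and a permutation t let F^t be F composed with
   rho^(1)_t, and let Sym_H be the sum of all F^s for s in a permutation group H,
   here either the full symmetric group or the stabiliser of the last letter.
   Permuting the arguments of the outer or of the inner operation before
   composing only permutes the arguments of the composite, so
     Sym_H (F^t o_m G) = Sym_H (F o_(t^-1 m) G),
     Sym_H (F o_m G^t) = Sym_H (F o_m G);
   both are checked on adjacent transpositions.  If F' and G' are sums of a
   transforms F^t and of b transforms G^t, summing over m therefore gives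
     sum_m Sym_H (F' o_m G') = a b sum_m Sym_H (F o_m G).
   For hat gamma, a b = (i-1)! (j-1)!, which cancels the denominator and leaves
   the symmetrized A_infinity relation.  For hat beta, a b = i j, which turns
   1/(i! j!) into 1/((i-1)! (j-1)!) and leaves the PL_infinity relation,
   symmetrized over the cosets of the stabiliser of the last letter. *)
Require Import Defs.
From HB Require Import structures.
From mathcomp Require Import all_boot all_order all_fingroup all_algebra.
From mathcomp Require Import boolp classical_sets functions cardinality fsbigop.
From mathcomp Require Import finmap zify.

Set Implicit Arguments.
Unset Strict Implicit.
Unset Printing Implicit Defensive.

Import Order.TTheory GRing.Theory Num.Theory.
Local Open Scope ring_scope.

(** * Koszul signs: multiplicativity, and the sign of a cycle *)

Section Signs.
Variable K : fieldType.
Implicit Types (a b : int) (n : nat).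

Lemma signzD a b : (-1 : K) ^ (a + b) = (-1) ^ a * (-1) ^ b.
Proof. by rewrite expfzDr // oppr_eq0 oner_eq0. Qed.

Lemma signzN a : (-1 : K) ^ (- a) = (-1) ^ a.
Proof. by rewrite -exprz_inv invrN1. Qed.

Lemma signz_sqr a : (-1 : K) ^ a * (-1) ^ a = 1.
Proof. by rewrite -{1}signzN -signzD addNr. Qed.

Lemma signz_sum (I : Type) (r : seq I) (P : pred I) (F : I -> int) :
  (-1 : K) ^ (\sum_(i <- r | P i) F i) = \prod_(i <- r | P i) (-1) ^ F i.
Proof. by apply: (big_morph _ signzD). Qed.

Lemma permute_mul (T : Type) n (s t : 'S_n) (x : n.-tuple T) :
  permute t (permute s x) = permute (t * s)%g x.
Proof. by apply: eq_from_tnth => k; rewrite !tnth_mktuple permM. Qed.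

Lemma permute1 (T : Type) n (x : n.-tuple T) : permute 1%g x = x.
Proof. by apply: eq_from_tnth => k; rewrite !tnth_mktuple perm1. Qed.

Lemma koszul1 n (d : n.-tuple int) : koszul K 1%g d = 1.
Proof.
rewrite /koszul big1 // => k _; rewrite big1 // => l; rewrite !perm1.
by case: ltngtP.
Qed.

(** Since [h] is symmetric, the product runs over unordered pairs, which [s] permutes. Pairs whose
    order [s] reverses are matched by exchanging the two coordinates. *)
Lemma prod_ord_pairs_perm n (s : 'S_n) (h : 'I_n -> 'I_n -> K) :
  (forall k l, h k l = h l k) ->
  \prod_(k < n) \prod_(l < n | (k < l)%N) h (s k) (s l) =
  \prod_(k < n) \prod_(l < n | (k < l)%N) h k l.
Proof.
move=> hC; rewrite !pair_big_dep /=.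
rewrite (reindex (fun p : 'I_n * 'I_n => ((s^-1)%g p.1, (s^-1)%g p.2))) /=; last first.
  by exists (fun p => (s p.1, s p.2)) => -[k l] _ /=; rewrite ?permK ?permKV.
under eq_bigr do rewrite !permKV.
rewrite (bigID (fun p : 'I_n * 'I_n => p.1 < p.2)%N) /= [RHS](bigID (fun p : 'I_n * 'I_n => (s^-1)%g p.1 < (s^-1)%g p.2)%N) /=.
congr (_ * _); first by apply: eq_bigl => p; rewrite andbC.
rewrite (reindex (fun p : 'I_n * 'I_n => (p.2, p.1))) /=; last first.
  by exists (fun p => (p.2, p.1)) => -[].
apply: eq_big => -[k l] //=; rewrite -leqNgt -leqNgt [RHS]andbC.
rewrite [in LHS]ltn_neqAle [in RHS]ltn_neqAle.
case: (k =P l) => [->|nkl]; first by rewrite !eqxx !andbF.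
rewrite !val_eqE (inj_eq perm_inj).
have /eqP/negPf-> := nkl; rewrite eq_sym; by have /eqP/negPf-> := nkl.
Qed.

(** The product [t * s] applies [t] first. It reverses a pair exactly when one, but not both, of [t]
    on the pair and [s] on its image under [t] does so; a pair reversed twice contributes the square
    of a sign, which is 1. *)
Lemma koszulM n (s t : 'S_n) (d : n.-tuple int) :
  koszul K (t * s)%g d = koszul K s d * koszul K t (permute s d).
Proof.
pose c (k l : 'I_n) : K := (-1) ^ (tnth d k * tnth d l).
(* The exclusive or detects a reversed pair without assuming [k < l], which makes [h] symmetric as
   [prod_ord_pairs_perm] demands. *)
pose h (u : 'S_n) (f : 'I_n -> 'I_n) (k l : 'I_n) : K :=
  if (k < l)%N (+) (u k < u l)%N then c (f k) (f l) else 1.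
have koszulE (u : 'S_n) (f : 'I_n -> 'I_n) :
    \prod_(k < n) \prod_(l < n | (k < l)%N && (u l < u k)%N) c (f k) (f l) =
    \prod_(k < n) \prod_(l < n | (k < l)%N) h u f k l.
  apply: eq_bigr => k _; rewrite big_mkcondr; apply: eq_bigr => l kl.
  rewrite /h kl ltn_neqAle leqNgt /=; case: ltngtP => // /val_inj/perm_inj lk.
  by rewrite lk ltnn in kl.
have -> : koszul K t (permute s d) =
    \prod_(k < n) \prod_(l < n | (k < l)%N && (t l < t k)%N) c (s (t k)) (s (t l)).
  by apply: eq_bigr => k _; apply: eq_bigr => l _; rewrite !tnth_mktuple.
rewrite (koszulE t (s \o t)) [koszul K s d](koszulE s s).
rewrite -(@prod_ord_pairs_perm _ t); last first.
  move=> k l; rewrite /h /c [tnth d (s l) * _]mulrC; congr (if _ then _ else _).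
  have [-> //|kl] := eqVneq k l.
  have ltC (a b : 'I_n) : a != b -> (b < a)%N = ~~ (a < b)%N.
    by move=> ab; rewrite -leqNgt [RHS]leq_eqVlt val_eqE eq_sym (negPf ab).
  by rewrite (ltC l k) ?(ltC (s l) (s k)) ?(inj_eq perm_inj) 1?eq_sym // addbN addNb negbK.
rewrite [LHS](koszulE (t * s)%g (t * s)%g) -big_split /=; apply: eq_bigr => k _.
rewrite -big_split /=; apply: eq_bigr => l kl.
rewrite /h /= kl !permM /=; have cc : c (s (t k)) (s (t l)) * c (s (t k)) (s (t l)) = 1.
  exact: signz_sqr.
by case: (t k < t l)%N; case: (s _ < s _)%N; rewrite /= ?mulr1 ?mul1r.
Qed.

(* The cycle bringing the letter in position b to position a <= b. *)
Definition cyc n (a b : 'I_n.+1) : 'S_n.+1 := lift_perm a b 1%g.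

Lemma cycE n (a b k : 'I_n.+1) : (a <= b)%N ->
  cyc a b k = (if (k < a)%N || (b < k)%N then k : nat
               else if k == a :> nat then b : nat else k.-1) :> nat.
Proof.
rewrite /cyc => ab; case: (unliftP a k) => [l ->|->]; last first.
  by rewrite lift_perm_id ltnn eqxx ltnNge ab.
rewrite lift_perm_lift perm1 /= /bump; case: (leqP b l); case: (leqP a l) => /= al bl; rewrite ?add0n ?add1n; repeat case: ifP; lia.
Qed.

(** The inversions of the cycle are the pairs formed by position [a], which holds letter [b], and
    one of the next [q] positions, which hold the letters from [a] to [b - 1]. *)
Lemma koszul_cyc n (a b : 'I_n.+1) q (d : n.+1.-tuple int) : b = (a + q)%N :> nat ->
  koszul K (cyc a b) d = (-1) ^ (d`_b * \sum_(l < q) d`_(a + l)%N).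
Proof.
move=> bE; have ab : (a <= b)%N by lia.
rewrite /koszul (bigD1 a) //= [X in _ * X]big1 ?mulr1; last first.
  move=> k ka; apply: big1 => l; rewrite !cycE //; move: ka; rewrite -val_eqE /=; repeat case: ifP; lia.
rewrite mulr_sumr signz_sum.
rewrite -(big_mkord predT (fun l => (-1) ^ (d`_b * d`_(a + l)%N))) /=.
(* Letters are traded for positions: position [l] with [a < l <= b] holds letter [l - 1]. *)
have := big_addn 0 b.+1 a.+1 predT (fun l => (-1 : K) ^ (d`_b * d`_l.-1)).
rewrite add0n (_ : b.+1 - a.+1 = q)%N; last by lia.
move=> E; rewrite (eq_bigr (fun l => (-1 : K) ^ (d`_b * d`_(l + a.+1).-1))); last first.
  by move=> l _; rewrite addnS addnC.
rewrite -E (@big_nat_widen _ _ _ _ b.+1 n.+1) ?ltn_ord //.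
rewrite (big_nat_widenl _ 0) // big_mkord; apply: eq_big => l.
  rewrite cycE // cycE // ltnn eqxx /=; case: (ltngtP l a) => ?; repeat case: ifP; try lia.
rewrite cycE // cycE // => ll; rewrite !(tnth_nth 0) !cycE // ltnn eqxx ltnNge ab /=.
congr (_ ^ (_ * d`_ _)); move: ll; rewrite ltnn eqxx; repeat case: ifP; lia.
Qed.

(** A fixed last letter takes part in no inversion. *)
Lemma koszul_fix_last n (s : 'S_n) (d : n.+1.-tuple int) :
  koszul K (fix_last s) d = koszul K s (drop_last d).
Proof.
rewrite /koszul big_ord_recr /= [X in _ * X]big1 ?mulr1; last first.
  move=> l; rewrite ltnNge -ltnS ltn_ord //.
have liftE (k : 'I_n) : widen_ord (leqnSn n) k = lift ord_max k.
  by apply: val_inj; rewrite /= /bump leqNgt ltn_ord.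
apply: eq_bigr => k _; rewrite big_mkcond big_ord_recr /= liftE /fix_last.
rewrite lift_perm_id lift_perm_lift lift_max [(n < s k)%N]ltnNge (ltnW (ltn_ord _)) andbF mulr1.
rewrite [RHS]big_mkcond; apply: eq_bigr => l _; rewrite liftE lift_perm_lift !tnth_mktuple.
by rewrite !lift_max.
Qed.
End Signs.

(** * Adjacent transpositions, and the stabiliser of the last letter *)

Lemma cyc_adj n (k l : 'I_n.+1) : l = k.+1 :> nat -> cyc k l = tperm k l.
Proof.
move=> kl; apply/permP => i; apply: val_inj; rewrite /= cycE; last by lia.
case: tpermP => [->|->|]; rewrite ?ltnn ?eqxx; rewrite -?val_eqE /=; try (repeat case: ifP; lia).
by move=> /eqP + /eqP; rewrite -!val_eqE /=; case: ifP => ?; last case: ifP => ?; lia.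
Qed.

(** Adjacent transpositions generate: exchanging [k] and [l] is conjugate, by the swap of [l - 1]
    and [l], to exchanging [k] and [l - 1], and transpositions generate the symmetric group. *)
Lemma adj_perm_ind n (P : 'S_n.+1 -> Prop) :
  P 1%g -> (forall s t, P s -> P t -> P (s * t)%g) ->
  (forall k l : 'I_n.+1, l = k.+1 :> nat -> P (cyc k l)) -> forall s, P s.
Proof.
move=> P1 PM Padj s.
have Pt (q : nat) (k l : 'I_n.+1) : l = (k + q.+1)%N :> nat -> P (tperm k l).
  elim: q k l => [|q IHq] k l kl; first by rewrite -cyc_adj; [apply: Padj|]; lia.
  have h : (k + q.+1 < n.+1)%N by have := ltn_ord l; lia.
  have -> : tperm k l = (tperm (Ordinal h) l * tperm k (Ordinal h) * tperm (Ordinal h) l)%g.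
    rewrite -{1}(tpermV (Ordinal h) l) -mulgA -/(conjg _ _) tpermJ tpermL tpermD //.
      by rewrite -val_eqE /=; lia.
    by rewrite -val_eqE /=; lia.
  have Ph : P (tperm (Ordinal h) l).
    by rewrite -cyc_adj; [apply: Padj|] => /=; lia.
  by apply: (PM _ _ (PM _ _ Ph _) Ph); apply: IHq.
have [ts -> _] := prod_tpermP s; elim: ts => [|[k l] ts IH]; rewrite ?big_nil ?big_cons //.
apply: PM => //=; case: (ltngtP k l) => [kl|lk|/val_inj ->]; last by rewrite tperm1; apply: P1.
  by apply: (Pt (l - k.+1)%N); lia.
by rewrite tpermC; apply: (Pt (k - l.+1)%N); lia.
Qed.

(** Injectivity suffices, as both sides have [(n+1)!] elements. The first coordinate is the image of
    the last letter, so this is the decomposition into cosets of its stabiliser. *)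
Lemma lift_perm_bij n :
  bijective (fun p : 'I_n.+1 * 'S_n => lift_perm ord_max p.1 p.2).
Proof.
apply: inj_card_bij; last by rewrite card_prod !card_Sn card_ord factS.
move=> [a s] [b u] /permP eq_f; have := eq_f ord_max; rewrite !lift_perm_id /= => ab.
move: eq_f; rewrite {}ab => eq_f; congr (_, _); apply/permP => k; apply: (@lift_inj _ b).
by have := eq_f (lift ord_max k); rewrite !lift_perm_lift.
Qed.

Lemma lift_perm_onto n (t : 'S_n.+1) : exists s, t = lift_perm ord_max (t ord_max) s.
Proof.
have [g _ gK] := lift_perm_bij n.
by exists (g t).2; rewrite -{1 2}(gK t) lift_perm_id.
Qed.

Lemma fix_last_inj n : injective (@fix_last n).
Proof.
move=> s t /permP st; apply/permP => k; apply: (@lift_inj _ ord_max).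
by have := st (lift ord_max k); rewrite !lift_perm_lift.
Qed.

(* [lastfix true n] is the full symmetric group on n.+1 letters and
   [lastfix false n] the stabiliser of the last letter. *)
Definition lastfix (e : bool) n : {set 'S_n.+1} :=
  [set s : 'S_n.+1 | e || (s ord_max == ord_max)].

Lemma lastfixM e n (s t : 'S_n.+1) :
  s \in lastfix e n -> (t * s \in lastfix e n)%g = (t \in lastfix e n).
Proof.
rewrite !inE; case: e => //= /eqP sl; rewrite permM.
by rewrite -{2}sl (inj_eq perm_inj).
Qed.

Lemma lastfixMl e n (s t : 'S_n.+1) :
  s \in lastfix e n -> (s * t \in lastfix e n)%g = (t \in lastfix e n).
Proof. by rewrite !inE; case: e => //= /eqP sl; rewrite permM sl. Qed.

Lemma lastfixP n (s : 'S_n.+1) : s \in lastfix false n -> exists t, s = fix_last t.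
Proof. by rewrite inE => /eqP sl; have [t] := lift_perm_onto s; rewrite sl; exists t. Qed.

Lemma fix_last_lastfix e n (s : 'S_n) : fix_last s \in lastfix e n.
Proof. by rewrite inE lift_perm_id eqxx orbT. Qed.

Lemma big_lastfix (R : nmodType) n (f : 'S_n.+1 -> R) :
  \sum_(s in lastfix false n) f s = \sum_(s : 'S_n) f (fix_last s).
Proof.
rewrite -(big_imset _ (in2W (@fix_last_inj n))); apply: eq_bigl => s.
by apply/idP/imsetP => [/lastfixP[t ->]|[t _ ->]]; [exists t|apply: fix_last_lastfix].
Qed.

Lemma card_lastfix n : #|lastfix false n| = n`!.
Proof.
rewrite -(card_Sn n) -cardsT -(card_imset _ (@fix_last_inj n)); apply: eq_card => s.
by apply/idP/imsetP => [/lastfixP[t ->]|[t _ ->]]; [exists t|apply: fix_last_lastfix].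
Qed.

Lemma lastfix_ind (e : bool) n (P : 'S_n.+1 -> Prop) :
  P 1%g -> (forall s t, P s -> P t -> P (s * t)%g) ->
  (forall k l : 'I_n.+1, l = k.+1 :> nat -> e || (l < n)%N -> P (cyc k l)) ->
  forall s, s \in lastfix e n -> P s.
Proof.
case: e => P1 PM Pc s.
  by move=> _; apply: adj_perm_ind s => // k l kl; apply: Pc.
(* With a single letter the stabiliser is trivial; otherwise the letters before the last are
   nonempty and [adj_perm_ind] applies to them. *)
move=> /lastfixP[t ->]; case: n => [|n] in P P1 PM Pc s t *.
  by have -> : fix_last t = 1%g by apply/permP => k; rewrite !ord1.
apply: (@adj_perm_ind n (fun t => P (fix_last t))) t.
- by rewrite /fix_last lift_perm1.
- by move=> t u; rewrite /fix_last -(lift_permM _ ord_max); apply: PM.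
move=> k l kl; have -> : fix_last (cyc k l) = cyc (lift ord_max k) (lift ord_max l).
  apply/permP => i; apply: val_inj; rewrite /= cycE ?lift_max; last by lia.
  case: (unliftP ord_max i) => [j|] ->; first by rewrite lift_perm_lift !lift_max cycE //; lia.
  by rewrite lift_perm_id /= (ltn_ord l) orbT.
by apply: Pc; rewrite !lift_max /=.
Qed.

(** * Permutations acting on graded multilinear maps, and partial composition *)

Section Twist.
Variables (K : fieldType) (V : lmodType K).
(** A vector alone does not determine a degree, zero having all of them. Attaching a degree as a
    formal label makes every Koszul sign a function of the argument, so the action can be studied
    before homogeneity is imposed. *)
Let T := (int * V)%type.
Let z0 : T := (0, 0).

Definition degs n (z : n.-tuple T) : n.-tuple int := [tuple (tnth z k).1 | k < n].
Definition vals n (z : n.-tuple T) : n.-tuple V := [tuple (tnth z k).2 | k < n].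

Definition slotwise_linear n (F : n.-tuple T -> V) : Prop :=
  forall (k : 'I_n) (y : n.-tuple T) (c : int) (b : K) (u v : V),
    let put w := [tuple if l == k then (c, w) else tnth y l | l < n] in
    F (put (b *: u + v)) = b *: F (put u) + F (put v).

Lemma multilinear_slotwise n (f : n.-tuple V -> V) :
  multilinear f -> slotwise_linear (fun z => f (vals z)).
Proof.
move=> flin k y c b u v /=.
have valsE w : vals [tuple if l == k then (c, w) else tnth y l | l < n] =
    [tuple if l == k then w else tnth (vals y) l | l < n].
  by apply: eq_from_tnth => l; rewrite !tnth_mktuple; case: eqP.
by rewrite !valsE flin.
Qed.

Lemma degs_permute n (s : 'S_n) (z : n.-tuple T) : degs (permute s z) = permute s (degs z).
Proof. by apply: eq_from_tnth => k; rewrite !tnth_mktuple. Qed.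

Lemma vals_permute n (s : 'S_n) (z : n.-tuple T) : vals (permute s z) = permute s (vals z).
Proof. by apply: eq_from_tnth => k; rewrite !tnth_mktuple. Qed.

Lemma nth_degs n (z : n.-tuple T) k : (degs z)`_k = (nth z0 z k).1.
Proof.
have [kn|nk] := ltnP k n; last by rewrite !nth_default ?size_tuple.
by have := tnth_mktuple (fun k => (tnth z k).1) (Ordinal kn); rewrite !(tnth_nth z0) (tnth_nth 0).
Qed.

Lemma nth_vals n (z : n.-tuple T) k : (vals z)`_k = (nth z0 z k).2.
Proof.
have [kn|nk] := ltnP k n; last by rewrite !nth_default ?size_tuple.
by have := tnth_mktuple (fun k => (tnth z k).2) (Ordinal kn); rewrite !(tnth_nth z0) (tnth_nth 0).
Qed.

Lemma nth_permute_cyc n (a b : 'I_n.+1) (z : n.+1.-tuple T) k : (a <= b)%N ->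
  nth z0 (permute (cyc a b) z) k =
  nth z0 z (if (k < a)%N || (b < k)%N then k else if k == a :> nat then b : nat else k.-1).
Proof.
move=> ab; have [kn|nk] := ltnP k n.+1; last first.
  rewrite (_ : (b < k)%N) ?orbT; last by have := ltn_ord b; lia.
  by rewrite !nth_default ?size_tuple.
have := tnth_mktuple (fun k => tnth z (cyc a b k)) (Ordinal kn).
by rewrite !(tnth_nth z0) cycE.
Qed.

(* The right action of permutations on maps: for F representing f, twist s F
   represents the composite of f with rho^(1)_s. *)
Definition twist n (s : 'S_n) (F : n.-tuple T -> V) (z : n.-tuple T) : V :=
  koszul K s (degs z) *: F (permute s z).

Lemma twist1 n (F : n.-tuple T -> V) : twist 1%g F = F.
Proof. by apply/funext => z; rewrite /twist koszul1 scale1r permute1. Qed.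

Lemma twistM n (s t : 'S_n) (F : n.-tuple T -> V) : twist s (twist t F) = twist (t * s)%g F.
Proof.
by apply/funext => z; rewrite /twist koszulM scalerA permute_mul degs_permute.
Qed.

Definition sym n (H : {set 'S_n}) (F : n.-tuple T -> V) (z : n.-tuple T) : V :=
  \sum_(s in H) twist s F z.

Lemma twist_sum n (s : 'S_n) (I : Type) (r : seq I) (P : pred I) (F : I -> n.-tuple T -> V) z :
  twist s (fun z => \sum_(i <- r | P i) F i z) z = \sum_(i <- r | P i) twist s (F i) z.
Proof. exact: scaler_sumr. Qed.

Lemma sym_sum n (H : {set 'S_n}) (I : Type) (r : seq I) (P : pred I) (F : I -> n.-tuple T -> V) z :
  sym H (fun z => \sum_(i <- r | P i) F i z) z = \sum_(i <- r | P i) sym H (F i) z.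
Proof. by rewrite exchange_big; apply: eq_bigr => s _; apply: twist_sum. Qed.

Lemma sym_twist e n (s : 'S_n.+1) (F : n.+1.-tuple T -> V) :
  s \in lastfix e n -> sym (lastfix e n) (twist s F) = sym (lastfix e n) F.
Proof.
move=> sH; apply/funext => z; rewrite /sym [RHS](reindex_inj (mulgI s)).
by apply: eq_big => t; rewrite ?lastfixMl // twistM.
Qed.

Lemma twist_sym e n (s : 'S_n.+1) (F : n.+1.-tuple T -> V) :
  s \in lastfix e n -> twist s (sym (lastfix e n) F) = sym (lastfix e n) F.
Proof.
move=> sH; apply/funext => z; rewrite twist_sum /sym [RHS](reindex_inj (mulIg s)).
by apply: eq_big => t; rewrite ?lastfixM // twistM.
Qed.

Section Compose.
Variables (p q : nat).
Implicit Types (F : p.-tuple T -> V) (G : q.-tuple T -> V) (m k : nat) (z : seq T).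

Definition block m z : q.-tuple T := [tuple nth z0 z (m + l) | l < q].

Definition slot m G z k : T :=
  if (k < m)%N then nth z0 z k
  else if k == m then (\sum_(l < q) (tnth (block m z) l).1 - 1, G (block m z))
  else nth z0 z (k + q).-1.

(* [insert] on pairs (degree, vector), with the degree of the inner value
   recorded in its slot. *)
Definition insert_pairs m F G z : V :=
  (-1 : K) ^ ((\sum_(k < m) (nth z0 z k).1) * -1) *: F [tuple slot m G z k | k < p].

Lemma block_eq m m' (z z' : seq T) :
  (forall l, (l < q)%N -> nth z0 z (m + l) = nth z0 z' (m' + l)) -> block m z = block m' z'.
Proof. by move=> zz'; apply: eq_from_tnth => l; rewrite !tnth_mktuple zz'. Qed.

Lemma slotE_lt m G z k : (k < m)%N -> slot m G z k = nth z0 z k.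
Proof. by rewrite /slot => ->. Qed.

Lemma slotE_eq m G z :
  slot m G z m = (\sum_(l < q) (tnth (block m z) l).1 - 1, G (block m z)).
Proof. by rewrite /slot ltnn eqxx. Qed.

Lemma slotE_gt m G z k : (m < k)%N -> slot m G z k = nth z0 z (k + q).-1.
Proof. by rewrite /slot; case: ltngtP. Qed.

(** [G] enters only through its value at one block, placed in one slot of [F]; the sign and the
    degree label of that slot depend on [z] alone. *)
Lemma insert_pairs_linear m F G G1 G2 z a :
  slotwise_linear F ->
  (m < p)%N ->
  G (block m z) = a *: G1 (block m z) + G2 (block m z) ->
  insert_pairs m F G z = a *: insert_pairs m F G1 z + insert_pairs m F G2 z.
Proof.
move=> Flin mp Gz; pose y := [tuple slot m G z k | k < p].
pose c := \sum_(l < q) (tnth (block m z) l).1 - 1.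
have slotE (G' : q.-tuple T -> V) : [tuple slot m G' z k | k < p] =
    [tuple if l == Ordinal mp then (c, G' (block m z)) else tnth y l | l < p].
  apply: eq_from_tnth => l; rewrite !tnth_mktuple -val_eqE /= /slot.
  by case: ltngtP.
by rewrite /insert_pairs !slotE Gz Flin scalerDr !scalerA [a * _]mulrC.
Qed.

Lemma insert_pairs0 m F z :
  slotwise_linear F ->
  (m < p)%N -> insert_pairs m F (fun=> 0) z = 0.
Proof.
(* With [a = -1] and zero maps, linearity reads X = -X + X, hence X = 0. *)
move=> Flin mp; rewrite (@insert_pairs_linear m F (fun=> 0) (fun=> 0) (fun=> 0) z (-1)) //.
  by rewrite scaleN1r addNr.
by rewrite scaler0 addr0.
Qed.

Lemma insert_pairs_scale m F G G1 z a :
  slotwise_linear F ->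
  (m < p)%N -> G (block m z) = a *: G1 (block m z) ->
  insert_pairs m F G z = a *: insert_pairs m F G1 z.
Proof.
move=> Flin mp Gz.
rewrite (@insert_pairs_linear m F G G1 (fun=> 0) z a) // ?addr0 //.
by rewrite insert_pairs0 ?addr0.
Qed.

Lemma insert_pairs_sum m F (I : Type) (r : seq I) (P : pred I) (G : I -> q.-tuple T -> V) z :
  slotwise_linear F ->
  (m < p)%N ->
  insert_pairs m F (fun w => \sum_(i <- r | P i) G i w) z = \sum_(i <- r | P i) insert_pairs m F (G i) z.
Proof.
move=> Flin mp; elim: r => [|x r IHr].
  rewrite big_nil -[RHS](insert_pairs0 z Flin mp); congr (insert_pairs m F _ z).
  by apply/funext => w; rewrite big_nil.
rewrite big_cons -IHr; case: (boolP (P x)) => Px; last first.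
  by congr (insert_pairs m F _ z); apply/funext => w; rewrite big_cons (negPf Px).
rewrite -[insert_pairs m F (G x) z]scale1r; apply: insert_pairs_linear => //.
by rewrite big_cons Px scale1r.
Qed.

End Compose.

(* Moving an element of degree e across a block of degree B costs e * B; moving
   it across the value of the degree -1 operation on the block costs e * (B - 1),
   and the operation itself no longer passes it. *)
Lemma sign_move (S B e : int) :
  (-1 : K) ^ (S * -1) * (-1) ^ (e * (B - 1)) = (-1) ^ (e * B) * (-1) ^ ((S + e) * -1).
Proof.
by rewrite -!signzD; congr (_ ^ _); lia.
Qed.

(** * Adjacent swaps carried through a partial composition *)

Section Moves.
Variables (i j : nat).
Implicit Types (F : i.+1.-tuple T -> V) (G : j.+1.-tuple T -> V) (z : (i + j).+1.-tuple T).

Lemma exists_ord (x : nat) : (x < (i + j).+1)%N -> exists a : 'I_(i + j).+1, a = x :> nat.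
Proof. by move=> xn; exists (Ordinal xn). Qed.

Lemma insert_pairs_twist_lt F G m (k l : 'I_i.+1) : l = k.+1 :> nat -> (l < m)%N -> (m < i.+1)%N ->
  exists a b : 'I_(i + j).+1, [/\ a = k :> nat, b = l :> nat &
   (fun z => insert_pairs m (twist (cyc k l) F) G z) = twist (cyc a b) (fun z => insert_pairs m F G z)].
Proof.
move=> kl lm mi.
have [a ak] : exists a : 'I_(i + j).+1, a = k :> nat by apply: exists_ord; lia.
have [b bl] : exists b : 'I_(i + j).+1, b = l :> nat by apply: exists_ord; lia.
exists a, b; split=> //; apply/funext => z.
rewrite /insert_pairs /twist !scalerA; congr (_ *: F _); last first.
  apply: eq_from_tnth => x; rewrite !tnth_mktuple cycE; last by lia.
  case: (ltngtP x m) => xm.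
  - rewrite [RHS]slotE_lt // nth_permute_cyc ?ak ?bl; last by lia.
    by rewrite slotE_lt //; case: ifP; last case: ifP; lia.
  - rewrite ifT; last by apply/orP; right; lia.
    rewrite !slotE_gt // nth_permute_cyc; last by lia.
    by congr nth; case: ifP => //; lia.
  - rewrite ifT xm; last by apply/orP; right; lia.
    rewrite !slotE_eq (@block_eq _ m m z (permute (cyc a b) z)) // => y yj.
    by rewrite nth_permute_cyc; [congr nth; case: ifP => //|]; lia.
rewrite (@koszul_cyc _ _ a b 1) ?ak ?addn1 ?bl // (@koszul_cyc _ _ k l 1) ?addn1 //.
rewrite !big_ord1 !addn0 !nth_degs -!tnth_nth !tnth_mktuple !slotE_lt //; last by lia.
rewrite mulrC; congr (_ * (-1) ^ (_ * _)).
(* The elements in front of the inner operation are only permuted among themselves, so their total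
   degree is unchanged. *)
case: m => // m in lm mi *.
have kl' : (k < m.+1)%N by lia.
rewrite [RHS](eq_bigr (fun x : 'I_m.+1 => (nth z0 z (cyc (Ordinal kl') (Ordinal lm) x)).1)); last first.
  by move=> x _; rewrite nth_permute_cyc ?cycE ?ak ?bl //=; lia.
exact: (reindex_perm (cyc (Ordinal kl') (Ordinal lm))).
Qed.

(** Swapping the slot of the inner value with the next one carries a single element across the whole
    block: on the composite this is a cycle through [j + 2] positions, and the insertion slot
    advances from [k] to [l]. *)
Lemma insert_pairs_twist_move F G (k l : 'I_i.+1) : l = k.+1 :> nat ->
  exists a b : 'I_(i + j).+1, [/\ a = k :> nat, b = (k + j.+1)%N :> nat &
   (fun z => insert_pairs k (twist (cyc k l) F) G z) = twist (cyc a b) (fun z => insert_pairs l F G z)].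
Proof.
move=> kl.
have [a ak] : exists a : 'I_(i + j).+1, a = k :> nat.
  by apply: exists_ord; have := ltn_ord k; lia.
have [b bl] : exists b : 'I_(i + j).+1, b = (k + j.+1)%N :> nat.
  by apply: exists_ord; have := ltn_ord l; lia.
exists a, b; split=> //; apply/funext => z; have ab : (a <= b)%N by lia.
rewrite /insert_pairs /twist !scalerA; congr (_ *: F _); last first.
  apply: eq_from_tnth => x; rewrite !tnth_mktuple cycE; last by lia.
  case: (ltngtP x k) => xk /=.
  - rewrite !slotE_lt ?nth_permute_cyc //; try lia.
    by rewrite ak xk.
  - case: (ltngtP x l) => xl /=.
    + lia.
    + rewrite !slotE_gt ?nth_permute_cyc //; try lia.
      congr nth; case: ifP; lia.
    + rewrite xl [RHS]slotE_eq (_ : (l : nat).-1 = k) ?kl // -{1}kl slotE_eq -kl.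
      rewrite (@block_eq _ k l z (permute (cyc a b) z)) // => y yj.
      rewrite nth_permute_cyc //; congr nth; case: ifP; last case: ifP; lia.
  - rewrite (_ : (l < x)%N = false) ?xk; last by lia.
    rewrite slotE_gt ?slotE_lt ?nth_permute_cyc //; try lia.
    congr nth; case: ifP; last case: ifP; lia.
(* After the move the inner operation also passes the element that came from position [b]; its
   degree is the [e] of [sign_move]. *)
have sum_l : \sum_(x < l) (nth z0 (permute (cyc a b) z) x).1 =
    \sum_(x < k) (nth z0 z x).1 + (nth z0 z b).1.
  rewrite kl big_ord_recr; congr (_ + _).
    by apply: eq_bigr => x _; rewrite nth_permute_cyc //= ak ltn_ord.
  by rewrite nth_permute_cyc //= ak ltnn eqxx ltnNge -ak ab.
have sum_block : \sum_(x < j.+1) (degs z)`_(a + x) = \sum_(x < j.+1) (tnth (block j.+1 k z) x).1.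
  by apply: eq_bigr => x _; rewrite nth_degs tnth_mktuple ak.
have ab' : b = (a + j.+1)%N :> nat by lia.
rewrite (@koszul_cyc _ _ a b j.+1 _ ab') (@koszul_cyc _ _ k l 1) ?addn1 // sum_block sum_l.
have klt : (k < l)%N by rewrite kl.
rewrite big_ord1 addn0 -!tnth_nth !tnth_mktuple slotE_eq slotE_gt //.
rewrite (_ : (l + j.+1).-1 = b); last by rewrite bl kl addSn.
by rewrite -(tnth_nth z0 z) sign_move.
Qed.

(** Behind the insertion slot, positions shift by [j] because [j + 1] elements fill that slot. *)
Lemma insert_pairs_twist_gt F G m (k l : 'I_i.+1) : l = k.+1 :> nat -> (m < k)%N ->
  exists a b : 'I_(i + j).+1, [/\ a = (k + j)%N :> nat, b = (l + j)%N :> nat &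
   (fun z => insert_pairs m (twist (cyc k l) F) G z) = twist (cyc a b) (fun z => insert_pairs m F G z)].
Proof.
move=> kl mk.
have [a ak] : exists a : 'I_(i + j).+1, a = (k + j)%N :> nat.
  by apply: exists_ord; have := ltn_ord k; lia.
have [b bl] : exists b : 'I_(i + j).+1, b = (l + j)%N :> nat.
  by apply: exists_ord; have := ltn_ord l; lia.
exists a, b; split=> //; apply/funext => z; have ab : (a <= b)%N by lia.
rewrite /insert_pairs /twist !scalerA; congr (_ *: F _); last first.
  apply: eq_from_tnth => x; rewrite !tnth_mktuple cycE; last by lia.
  case: (ltngtP x m) => xm.
  - rewrite ifT; last by apply/orP; left; lia.
    rewrite !slotE_lt // nth_permute_cyc // ifT //; apply/orP; left; lia.
  - rewrite [RHS]slotE_gt // nth_permute_cyc //.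
    rewrite slotE_gt; last by case: ifP => ?; last case: ifP => ?; lia.
    congr nth; rewrite ak bl; do 2!case: ifP => ?; try lia; do 2!(case: ifP => ?; try lia).
  - rewrite ifT xm; last by apply/orP; left; lia.
    rewrite !slotE_eq (@block_eq _ m m z (permute (cyc a b) z)) // => y yj.
    by rewrite nth_permute_cyc // ifT //; apply/orP; left; lia.
rewrite (@koszul_cyc _ _ a b 1) ?addn1 ?ak ?bl ?kl // (@koszul_cyc _ _ k l 1) ?addn1 //.
rewrite !big_ord1 !addn0 !nth_degs -!tnth_nth !tnth_mktuple !slotE_gt //; last by lia.
rewrite mulrC !addnS /= -ak -bl -!(tnth_nth z0 z); congr (_ * (-1) ^ (_ * _)).
  by rewrite (tnth_nth z0 z b) bl kl.
rewrite -/(permute (cyc a b) z).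
apply: eq_bigr => x _; rewrite nth_permute_cyc // ifT //; apply/orP; left.
by have := ltn_ord x; lia.
Qed.

Lemma insert_pairs_inner_twist F G m (k l : 'I_j.+1) :
  slotwise_linear F ->
  l = k.+1 :> nat -> (m < i.+1)%N ->
  exists a b : 'I_(i + j).+1, [/\ a = (m + k)%N :> nat, b = (m + l)%N :> nat &
   (fun z => insert_pairs m F (twist (cyc k l) G) z) = twist (cyc a b) (fun z => insert_pairs m F G z)].
Proof.
move=> Flin kl mi.
have [a ak] : exists a : 'I_(i + j).+1, a = (m + k)%N :> nat.
  by apply: exists_ord; have := ltn_ord k; lia.
have [b bl] : exists b : 'I_(i + j).+1, b = (m + l)%N :> nat.
  by apply: exists_ord; have := ltn_ord l; lia.
exists a, b; split=> //; apply/funext => z; have ab : (a <= b)%N by lia.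
have kl' : (k <= l)%N by lia.
have blockE : block j.+1 m (permute (cyc a b) z) = permute (cyc k l) (block j.+1 m z).
  apply: eq_from_tnth => x; rewrite !tnth_mktuple nth_permute_cyc // cycE // ak bl.
  congr nth; do 2!case: ifP => ?; try lia; do 2!(case: ifP => ?; try lia).
(* Freezing the inner map to its value at the permuted block lets slotwise linearity pull out the
   Koszul sign. *)
rewrite (insert_pairs_scale (G1 := fun=> G (permute (cyc k l) (block j.+1 m z))) Flin mi (erefl _)).
have ab' : b = (a + 1)%N :> nat by lia.
rewrite /twist (@koszul_cyc _ _ a b 1 _ ab') (@koszul_cyc _ _ k l 1) ?addn1 //.
rewrite !big_ord1 !addn0 -!tnth_nth !tnth_mktuple -ak -bl -!(tnth_nth z0 z); congr (_ *: _).
rewrite /insert_pairs; congr (_ *: F _).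
  congr (_ ^ (_ * _)); apply: eq_bigr => x _; rewrite nth_permute_cyc // ifT //.
  by apply/orP; left; have := ltn_ord x; lia.
apply: eq_from_tnth => x; rewrite !tnth_mktuple.
case: (ltngtP x m) => xm.
- rewrite !slotE_lt // nth_permute_cyc // ifT //; apply/orP; left; lia.
- rewrite !slotE_gt // nth_permute_cyc // ifT //; apply/orP; right.
  by have := ltn_ord l; lia.
- rewrite xm !slotE_eq blockE; congr (_ - _, _).
  (* The degree label of the inner value depends only on the total degree of the block. *)
  rewrite [LHS](reindex_perm (cyc k l)).
  by apply: eq_bigr => y _; rewrite [in RHS]tnth_mktuple.
Qed.

Lemma cyc_lastfix (e : bool) (a b : 'I_(i + j).+1) :
  (a <= b)%N -> e || (b < i + j)%N -> cyc a b \in lastfix e (i + j).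
Proof.
move=> ab; rewrite inE; case: e => //= bn.
by apply/eqP/val_inj; rewrite /= cycE //= bn orbT.
Qed.

(** Each adjacent swap of outer slots becomes a cycle on the composite, absorbed by the
    symmetrization, and moves the insertion slot accordingly. A swap avoiding the last outer slot
    gives a cycle avoiding the last letter, so both groups are treated alike. *)
Lemma sym_insert_twist e F G (t : 'S_i.+1) (m : 'I_i.+1) : t \in lastfix e i ->
  sym (lastfix e (i + j)) (fun z => insert_pairs m (twist t F) G z) =
  sym (lastfix e (i + j)) (fun z => insert_pairs ((t^-1)%g m) F G z).
Proof.
move=> te; elim/lastfix_ind: te F m => [F m|s u IHs IHu F m|k l kl le F m].
- by rewrite invg1 perm1 twist1.
- by rewrite -twistM IHu IHs invMg permM.
have cycV : ((cyc k l)^-1)%g = tperm k l by rewrite cyc_adj // tpermV.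
rewrite {}cycV; case: (ltngtP m k) => mk.
- have [a [b [ak bl ->]]] := insert_pairs_twist_gt F G kl mk.
  rewrite tpermD -?val_eqE /= ?sym_twist //; [|lia|lia].
  by apply: cyc_lastfix; [lia|move: le; case: (e) => //=; lia].
- case: (ltngtP m l) => ml; first by lia.
    have [a [b [ak bl ->]]] := insert_pairs_twist_lt F G kl ml (ltn_ord m).
    rewrite tpermD -?val_eqE /= ?sym_twist //; [|lia|lia].
    by apply: cyc_lastfix; [lia|move: le; case: (e) => //=; lia].
  rewrite (val_inj ml) tpermR.
  (* The move is read backwards: applied to the already swapped [F], it cancels the swap, which is
     an involution. *)
  have [a [b [ak bl E]]] := insert_pairs_twist_move (twist (cyc k l) F) G kl.
  move: E; rewrite twistM cyc_adj // tperm2 twist1 => ->; rewrite sym_twist //.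
  by apply: cyc_lastfix; [lia|move: le; case: (e) => //=; lia].
rewrite (val_inj mk) tpermL.
have [a [b [ak bl ->]]] := insert_pairs_twist_move F G kl; rewrite sym_twist //.
by apply: cyc_lastfix; [lia|move: le; case: (e) => //=; lia].
Qed.

Lemma sym_insert_inner_twist e F G (t : 'S_j.+1) m :
  slotwise_linear F -> (m < i.+1)%N -> t \in lastfix e j ->
  sym (lastfix e (i + j)) (fun z => insert_pairs m F (twist t G) z) =
  sym (lastfix e (i + j)) (fun z => insert_pairs m F G z).
Proof.
move=> Flin mi te; elim/lastfix_ind: te G => [G|s u IHs IHu G|k l kl le G].
- by rewrite twist1.
- by rewrite -twistM IHu IHs.
have [a [b [ak bl ->]]] := insert_pairs_inner_twist G Flin kl mi; rewrite sym_twist //.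
by apply: cyc_lastfix; [lia|move: le; case: (e) => //=; lia].
Qed.

Lemma sym_insert_sums e F G (X : {set 'S_i.+1}) (Y : {set 'S_j.+1}) z :
  slotwise_linear F -> X \subset lastfix e i -> Y \subset lastfix e j ->
  \sum_(m < i.+1) sym (lastfix e (i + j)) (fun z => insert_pairs m (fun y => \sum_(s in X) twist s F y)
                              (fun w => \sum_(t in Y) twist t G w) z) z =
  (\sum_(m < i.+1) sym (lastfix e (i + j)) (fun z => insert_pairs m F G z) z) *+ (#|X| * #|Y|).
Proof.
move=> Flin /fintype.subsetP Xe /fintype.subsetP Ye; pose G' w := \sum_(t in Y) twist t G w.
rewrite -/G'.
transitivity (\sum_(s in X) \sum_(m < i.+1) sym (lastfix e (i + j)) (fun z => insert_pairs m F G' z) z).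
  rewrite [RHS](eq_bigr (fun s => \sum_(m < i.+1) sym (lastfix e (i + j))
     (fun z => insert_pairs m (twist s F) G' z) z)); last first.
    (* A single slot is not preserved by the twist, but the sum over all slots is: reindexing by
       [s^-1] accounts for the displacement. *)
    move=> s /Xe se; rewrite (reindex_inj (@perm_inj _ (s^-1)%g)); apply: eq_bigr => m _.
    by rewrite sym_insert_twist.
  rewrite [RHS]exchange_big; apply: eq_bigr => m _; rewrite -sym_sum.
  by congr sym; apply/funext => y; rewrite /insert_pairs scaler_sumr.
rewrite sumr_const mulnC mulrnA; congr (_ *+ _); rewrite -sumrMnl; apply: eq_bigr => m _.
rewrite -sumr_const [RHS](eq_bigr (fun t => sym (lastfix e (i + j)) (fun z => insert_pairs m F (twist t G) z) z)).
  rewrite -sym_sum; congr sym; apply/funext => y; exact: insert_pairs_sum.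
by move=> t /Ye te; rewrite sym_insert_inner_twist.
Qed.

End Moves.
End Twist.

(** * Linearity of components and multilinearity of extended maps *)

Section Extend.
Variables (K : fieldType) (V : lmodType K) (G : grading V).

Lemma piece_scale i a u : G i u -> G i (a *: u).
Proof. by move=> Gu; rewrite -[_ *: _]addr0; apply: piece_lin => //; apply: piece0. Qed.

Lemma piece_sum i (I : Type) (r : seq I) (P : pred I) (F : I -> V) :
  (forall x, P x -> G i (F x)) -> G i (\sum_(x <- r | P x) F x).
Proof.
move=> GF; elim/big_ind: _ => //; first exact: piece0.
by move=> u v Gu Gv; rewrite -[u]scale1r; apply: piece_lin.
Qed.

Lemma component_spec v : [/\ forall i, G i (component G i v),
    finite_set [set i | component G i v != 0]%classic
  & v = \sum_(i \in [set: int]%classic) component G i v].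
Proof. by rewrite /component; case: cid => c []. Qed.

Lemma component_unique (v : V) (c : int -> V) :
  [/\ forall i, G i (c i), finite_set [set i | c i != 0]%classic
   & v = \sum_(i \in [set: int]%classic) c i] -> (fun i => component G i v) = c.
Proof.
move=> cP; have [c' [_ c'_unique]] := piece_direct G v.
by rewrite -(c'_unique _ cP) -(c'_unique _ (component_spec v)).
Qed.

(** A sum with infinite support takes the default value 0, so linearity is obtained on a common
    finite set [A] outside which both summands vanish. *)
Lemma fsum_linear (I : choiceType) (A : set I) (a : K) (f g h : I -> V) :
  finite_set A -> (forall i, ~ A i -> g i = 0) -> (forall i, ~ A i -> h i = 0) ->
  (forall i, f i = a *: g i + h i) ->
  \sum_(i \in [set: I]%classic) f i =
  a *: (\sum_(i \in [set: I]%classic) g i) + \sum_(i \in [set: I]%classic) h i.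
Proof.
move=> finA g0 h0 fE.
have nA i : i \notin fset_set A -> ~ A i.
  by rewrite in_fset_set // => /negP nAi Ai; apply: nAi; apply: mem_set.
rewrite !(fsbigTE (fset_set A)).
- by rewrite (eq_bigr _ (fun i _ => fE i)) big_split scaler_sumr.
- by move=> i /nA /h0.
- by move=> i /nA /g0.
- by move=> i /nA Ai; rewrite fE g0 // h0 // scaler0 addr0.
Qed.

(** The combined components form a decomposition of [a *: u + v], and decompositions are unique. *)
Lemma component_linear i a u v :
  component G i (a *: u + v) = a *: component G i u + component G i v.
Proof.
have [Gu fu uE] := component_spec u; have [Gv fv vE] := component_spec v.
pose A := ([set i | component G i u != 0%R] `|` [set i | component G i v != 0%R])%classic.
have finA : finite_set A by rewrite finite_setU.
have u0 k : ~ A k -> component G k u = 0.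
  by move=> nA; apply/eqP; apply: contra_notT nA => ?; left.
have v0 k : ~ A k -> component G k v = 0.
  by move=> nA; apply/eqP; apply: contra_notT nA => ?; right.
have E : (fun i => component G i (a *: u + v)) =
    fun i => a *: component G i u + component G i v.
  apply: component_unique; split.
  - by move=> k; apply: piece_lin.
  - apply: sub_finite_set finA => k /= nz; apply: contrapT => nA; case/eqP: nz.
    by rewrite u0 // v0 // scaler0 addr0.
  by rewrite {1}uE {1}vE; apply/esym; apply: (fsum_linear finA).
exact: (congr1 (@^~ i) E).
Qed.

Lemma finite_tuples n (I : eqType) (A : set I) :
  finite_set A -> finite_set [set t : n.-tuple I | forall k, A (tnth t k)]%classic.
Proof.
move=> /finite_seqP[r ->].
pose f (g : {ffun 'I_n -> 'I_(size r)}) := [tuple tnth (in_tuple r) (g k) | k < n].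
apply: (@sub_finite_set _ _ (f @` setT)%classic); last exact/finite_image/finite_finset.
move=> t /= rt; have rt' k : (index (tnth t k) r < size r)%N by rewrite index_mem; apply: rt.
exists [ffun k => Ordinal (rt' k)] => //.
by apply: eq_from_tnth => k; rewrite tnth_mktuple ffunE (tnth_nth (tnth t k)) /= nth_index //; apply: rt.
Qed.

Lemma extend_multilinear n (F : n.-tuple int -> n.-tuple V -> V) :
  (forall d, multilinear (F d)) -> multilinear (extend G F).
Proof.
move=> Flin k x a u v /=.
pose supp w := [set i | component G i w != 0%R]%classic.
have suppF w i : ~ supp w i -> component G i w = 0.
  by move=> nw; apply/eqP; apply: contra_notT nw.
(* [A] gathers all degrees occurring in the entries; a degree tuple leaving [A] produces a zero
   entry, so finitely many tuples contribute. *)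
pose A := (\bigcup_(l in [set: 'I_n]) supp (tnth x l) `|` (supp u `|` supp v))%classic.
have finA : finite_set A.
  rewrite !finite_setU; split; last by split; case: (component_spec u) (component_spec v) => _ + _ [].
  by apply: bigcup_finite => [|l _]; [apply: finite_finset|case: (component_spec (tnth x l))].
have F0 (d : n.-tuple int) w : (supp w `<=` A)%classic -> ~ (forall l, A (tnth d l)) ->
    F d [tuple component G (tnth d l)
           (tnth [tuple if l == k then w else tnth x l | l < n] l) | l < n] = 0.
  move=> wA /existsNP[l nAl]; apply: (multilinear_eq0 (k := l) (Flin d)).
  rewrite !tnth_mktuple; apply: suppF; apply: contra_not nAl.
  by case: eqP => _; [apply: wA|left; exists l].
apply: (fsum_linear (finite_tuples n finA)) => d /=.
- by apply: F0 => i; right; left.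
- by apply: F0 => i; right; right.
have putE w : [tuple component G (tnth d l)
           (tnth [tuple if l == k then w else tnth x l | l < n] l) | l < n] =
    [tuple if l == k then component G (tnth d k) w
     else tnth [tuple component G (tnth d l) (tnth x l) | l < n] l | l < n].
  by apply: eq_from_tnth => l; rewrite !tnth_mktuple; case: eqP => // ->.
by rewrite !putE component_linear Flin.
Qed.
End Extend.

(** * Operations averaged over a set of permutations *)

Section Averaging.
Variables (K : fieldType) (V : lmodType K) (G : grading V).
Let T := (int * V)%type.

Definition homogeneous_pairs n (z : n.-tuple T) := homogeneous G (degs z) (vals z).

Lemma homogeneous_permute n (s : 'S_n) (z : n.-tuple T) :
  homogeneous_pairs z -> homogeneous_pairs (permute s z).
Proof. by move=> Gz k; have := Gz (s k); rewrite !tnth_mktuple. Qed.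

Variables (X : forall n, {set 'S_n.+1}) (mu : operations V).
Hypothesis mu_deg : operations_degN1 G mu.

(* Both hat gamma and hat beta are of this form: X is the stabiliser of the
   last letter for hat gamma, and Sh(n, 1) for hat beta. *)
Definition averaged : operations V :=
  fun n => extend G (fun d x => \sum_(s in X n) koszul K s d *: mu (permute s x)).

Lemma averagedE n (z : n.+1.-tuple T) : homogeneous_pairs z ->
  averaged (vals z) = \sum_(s in X n) twist s (fun y => mu (vals y)) z.
Proof.
move=> Gz; have mulin := (mu_deg n).1.
rewrite /averaged (extendE _ Gz); last first.
  move=> d x k xk0; apply: big1 => s _.
  by rewrite (permute_eq0 _ mulin xk0) scaler0.
by apply: eq_bigr => s _; rewrite /twist vals_permute.
Qed.

Definition pairs n (d : n.-tuple int) (x : n.-tuple V) : n.-tuple T :=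
  [tuple (tnth d k, tnth x k) | k < n].

Lemma degs_pairs n (d : n.-tuple int) (x : n.-tuple V) : degs (pairs d x) = d.
Proof. by apply: eq_from_tnth => k; rewrite !tnth_mktuple. Qed.

Lemma vals_pairs n (d : n.-tuple int) (x : n.-tuple V) : vals (pairs d x) = x.
Proof. by apply: eq_from_tnth => k; rewrite !tnth_mktuple. Qed.

Lemma homogeneous_pairsP n (d : n.-tuple int) (x : n.-tuple V) :
  homogeneous G d x -> homogeneous_pairs (pairs d x).
Proof. by rewrite /homogeneous_pairs degs_pairs vals_pairs. Qed.

Lemma averaged_deg : operations_degN1 G averaged.
Proof.
move=> n; have [mulin mudeg] := mu_deg n; split.
  apply: extend_multilinear => d k x a u v /=.
  rewrite scaler_sumr -big_split; apply: eq_bigr => s _ /=.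
  rewrite scalerA mulrC -scalerA -scalerDr; congr (_ *: _).
  (* Slot [k] of the original tuple is slot [s^-1 k] of the permuted one. *)
  have permute_put w : permute s [tuple if l == k then w else tnth x l | l < n.+1] =
      [tuple if l == (s^-1)%g k then w else tnth (permute s x) l | l < n.+1].
    apply: eq_from_tnth => l; rewrite !tnth_mktuple.
    by rewrite -[in RHS](inj_eq (@perm_inj _ s)) permKV.
  by rewrite !permute_put mulin.
move=> d x dx; have := averagedE (homogeneous_pairsP dx); rewrite vals_pairs => ->.
apply: piece_sum => s _; apply: piece_scale; rewrite vals_permute vals_pairs.
have -> : \sum_(k < n.+1) tnth d k = \sum_(k < n.+1) tnth (permute s d) k.
  by rewrite (reindex_perm s); apply: eq_bigr => k _; rewrite tnth_mktuple.
by apply: mudeg => k; rewrite !tnth_mktuple.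
Qed.

Lemma insert_pairsE p q m (f : p.-tuple V -> V) (g : q.-tuple V -> V) n (z : n.-tuple T) :
  insert m f g (degs z) (vals z) = insert_pairs m (fun y => f (vals y)) (fun w => g (vals w)) z.
Proof.
rewrite /insert /insert_pairs big_mkord; congr (_ ^ (_ * _) *: f _).
  by apply: eq_bigr => k _; rewrite nth_degs.
apply: eq_from_tnth => k; rewrite !tnth_mktuple /slot.
case: (k < m)%N; rewrite ?nth_vals //; case: (k == m :> nat); rewrite ?nth_vals //=.
by congr g; apply: eq_from_tnth => l; rewrite !tnth_mktuple nth_vals.
Qed.

(** The explicit sum for [averaged] is available on homogeneous arguments only. The outer arguments
    qualify because the inner value has the degree recorded in its slot, [averaged] being of degree
    -1. *)
Lemma insert_pairs_averaged i j m (z : (i + j).+1.-tuple T) : (m < i.+1)%N -> homogeneous_pairs z ->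
  insert_pairs m (fun y : i.+1.-tuple T => averaged (vals y)) (fun w : j.+1.-tuple T => averaged (vals w)) z =
  insert_pairs m (fun y : i.+1.-tuple T => \sum_(s in X i) twist s (fun y => mu (vals y)) y)
         (fun w : j.+1.-tuple T => \sum_(s in X j) twist s (fun y => mu (vals y)) w) z.
Proof.
move=> mi Gz.
have Gnth k : (k < (i + j).+1)%N -> G (nth (0, 0) z k).1 (nth (0, 0) z k).2.
  by move=> kn; have := Gz (Ordinal kn); rewrite !tnth_mktuple (tnth_nth (0, 0)).
have Gblock : homogeneous_pairs (block j.+1 m z).
  by move=> l; rewrite !tnth_mktuple; apply: Gnth; have := ltn_ord l; lia.
rewrite /insert_pairs /slot -(averagedE Gblock); congr (_ *: _); rewrite averagedE // => k.
rewrite !tnth_mktuple; case: ltngtP => km /=.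
- by apply: Gnth; lia.
- by apply: Gnth; have := ltn_ord k; lia.
have := (averaged_deg j).2 _ _ Gblock; congr (G (_ + _) _).
by apply: eq_bigr => l _; rewrite tnth_mktuple.
Qed.

Lemma sym_eq n (H : {set 'S_n}) (F F' : n.-tuple T -> V) z : homogeneous_pairs z ->
  (forall y, homogeneous_pairs y -> F y = F' y) -> sym H F z = sym H F' z.
Proof.
move=> Gz FF'; apply: eq_bigr => s _; rewrite /twist FF' //; exact: homogeneous_permute.
Qed.

Definition insertion (nu : operations V) n i m (z : n.+1.-tuple T) : V :=
  insert m (nu i) (nu (n - i)%N) (degs z) (vals z).

Lemma sym_insertion_averaged e n (i : 'I_n.+1) (z : n.+1.-tuple T) :
  (forall n, X n \subset lastfix e n) -> homogeneous_pairs z ->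
  \sum_(m < i.+1) sym (lastfix e n) (insertion (@averaged) i m) z =
  (\sum_(m < i.+1) sym (lastfix e n) (insertion (@mu) i m) z) *+ (#|X i| * #|X (n - i)|).
Proof.
(* Writing [n] as [i + j] gives the tuples the arity required by the composition results. *)
move=> Xe; have := subnKC (ltnSE (ltn_ord i)); move: (nat_of_ord i) => {}i.
rewrite /insertion; move: (n - i)%N => j nE; case: n / nE z => z Gz.
have := sym_insert_sums (fun w : j.+1.-tuple T => mu (vals w)) z
  (multilinear_slotwise (mu_deg i).1) (Xe i) (Xe j).
under [X in _ = X *+ _ -> _]eq_bigr do under eq_fun do rewrite -insert_pairsE.
move=> <-; apply: eq_bigr => m _; apply: sym_eq => // y Gy.
by rewrite insert_pairsE insert_pairs_averaged.
Qed.

End Averaging.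

(** * Shuffles as coset representatives of the stabiliser *)

Section Shuffles.
Variables (K : fieldType) (V : lmodType K) (G : grading V).
Let T := (int * V)%type.

(** An increasing permutation satisfies [k <= s k] by induction; its inverse is increasing too,
    which gives the reverse inequality. *)
Lemma increasing_perm n (s : 'S_n) :
  (forall k l : 'I_n, (k < l)%N -> (s k < s l)%N) -> s = 1%g.
Proof.
move=> s_incr; have le_incr (t : 'S_n) (k : 'I_n) :
    (forall k l : 'I_n, (k < l)%N -> (t k < t l)%N) -> (k <= t k)%N.
  move=> t_incr; case: k => k; elim: k => [//|k IHk] kn.
  exact: leq_ltn_trans (IHk (ltnW kn)) (t_incr _ _ _).
apply/permP => k; rewrite perm1; apply/val_inj/anti_leq; rewrite [X in _ && X]le_incr // andbT.
rewrite -{2}(permK s k) le_incr // => {}k l kl; rewrite ltnNge leq_eqVlt negb_or.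
rewrite val_eqE (inj_eq perm_inj) -val_eqE (gtn_eqF kl) /=.
by apply/negP => /s_incr; rewrite !permKV => /ltnW; rewrite leqNgt kl.
Qed.

(** Once the image [a] of the last letter is chosen, the remaining letters must follow in increasing
    order. *)
Lemma shuffle1P n (s : 'S_n.+1) :
  reflect (exists a, s = lift_perm ord_max a 1%g) (s \in shuffle1 n).
Proof.
apply: (iffP idP) => [|[a ->]]; rewrite inE.
  move=> /forallP s_incr; have [t st] := lift_perm_onto s; exists (s ord_max).
  rewrite {1}st; congr lift_perm; apply: increasing_perm => k l kl.
  have /forallP/(_ (lift ord_max l))/implyP := s_incr (lift ord_max k).
  rewrite !lift_max kl ltn_ord st !lift_perm_lift => /(_ isT).
  by rewrite /= /bump; case: leqP; case: leqP => /=; lia.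
apply/forallP => k; apply/forallP => l; apply/implyP.
case: (unliftP ord_max k) => [k'|] ->; last by rewrite /= => /andP[]; lia.
case: (unliftP ord_max l) => [l'|] ->; last by rewrite /= ltnn andbF.
rewrite !lift_max !lift_perm_lift !perm1 => /andP[kl _] /=; rewrite /bump.
by case: leqP; case: leqP => /=; lia.
Qed.

Lemma big_shuffle1 (R : nmodType) n (f : 'S_n.+1 -> R) :
  \sum_(s in shuffle1 n) f s = \sum_(a < n.+1) f (lift_perm ord_max a 1%g).
Proof.
have inj_sh : injective (fun a : 'I_n.+1 => lift_perm ord_max a (1%g : 'S_n)).
  by move=> a b /permP/(_ ord_max); rewrite !lift_perm_id.
rewrite -(big_imset _ (in2W inj_sh)); apply: eq_bigl => s.
by apply/shuffle1P/imsetP => [[a ->]|[a _ ->]]; exists a.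
Qed.

Lemma card_shuffle1 n : #|shuffle1 n| = n.+1.
Proof.
have inj_sh : injective (fun a : 'I_n.+1 => lift_perm ord_max a (1%g : 'S_n)).
  by move=> a b /permP/(_ ord_max); rewrite !lift_perm_id.
rewrite -[RHS]card_ord -cardsT -(card_imset _ inj_sh); apply: eq_card => s.
by apply/shuffle1P/imsetP => [[a ->]|[a _ ->]]; exists a.
Qed.

Lemma sum_Sn_lift (R : nmodType) n (f : 'S_n.+1 -> R) :
  \sum_(s : 'S_n.+1) f s = \sum_(a < n.+1) \sum_(s : 'S_n) f (lift_perm ord_max a s).
Proof.
rewrite pair_big (reindex (fun p : 'I_n.+1 * 'S_n => lift_perm ord_max p.1 p.2)) //.
exact/onW_bij/lift_perm_bij.
Qed.

Lemma sym_full_stab n (F : n.+1.-tuple T -> V) z :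
  sym (lastfix true n) (sym (lastfix false n) F) z = sym (lastfix true n) F z *+ n`!.
Proof.
rewrite -(card_lastfix n) -sumr_const sym_sum; apply: eq_bigr => s _.
by rewrite sym_twist // inE.
Qed.

(** Every permutation factors as an element of the stabiliser followed by the shuffle of its coset,
    and [F] does not see the first factor on homogeneous arguments; each shuffle is therefore
    counted [n!] times. *)
Lemma sym_symmetric n (F : n.+1.-tuple T -> V) z :
  (forall (s : 'S_n) y, homogeneous_pairs G y -> twist (fix_last s) F y = F y) ->
  homogeneous_pairs G z ->
  sym (lastfix true n) F z = (\sum_(s in shuffle1 n) twist s F z) *+ n`!.
Proof.
move=> Fsym Gz; rewrite /sym (eq_bigl predT) => [|s]; last by rewrite inE.
rewrite sum_Sn_lift big_shuffle1 -sumrMnl; apply: eq_bigr => a _.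
rewrite -card_Sn -sumr_const; apply: eq_big => [s|s _]; first by rewrite inE.
have -> : lift_perm ord_max a s = (fix_last s * lift_perm ord_max a 1)%g.
  by rewrite lift_permM mulg1.
by rewrite -twistM /twist -/(twist _ F _) Fsym //; apply: homogeneous_permute.
Qed.

End Shuffles.

(** * The two structures obtained by averaging *)

Section Main.
Variables (K : fieldType) (V : lmodType K) (G : grading V) (mu : operations V).
Hypothesis char0 : [pchar K] =i pred0.

Lemma gamma_hat_averaged : gamma_hat G mu = averaged G (lastfix false) mu.
Proof.
apply: functional_extensionality_dep => n; rewrite /gamma_hat /averaged; congr extend.
apply/funext => d; apply/funext => x; rewrite big_lastfix; apply: eq_bigr => s _.
by rewrite koszul_fix_last.
Qed.

Lemma natr_neq0 n : (0 < n)%N -> n%:R != 0 :> K.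
Proof. by rewrite lt0n; have /pcharf0P -> := char0. Qed.

Lemma fact_pair_neq0 i j : (i`! * j`!)%N%:R != 0 :> K.
Proof. by rewrite natr_neq0 // muln_gt0 !fact_gt0. Qed.

Lemma sum_fix_last_insertion (nu : operations V) n i m (d : n.+1.-tuple int) (x : n.+1.-tuple V) :
  \sum_(s : 'S_n) koszul K s (drop_last d) *:
        insert m (nu i) (nu (n - i)%N)
          (permute (fix_last s) d) (permute (fix_last s) x) =
  sym (lastfix false n) (insertion nu i m) (pairs d x).
Proof.
rewrite /sym big_lastfix; apply: eq_bigr => s _.
by rewrite /twist /insertion degs_permute vals_permute degs_pairs vals_pairs koszul_fix_last.
Qed.

Lemma sum_insertion (nu : operations V) n i m (d : n.+1.-tuple int) (x : n.+1.-tuple V) :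
  \sum_(s : 'S_n.+1) koszul K s d *:
        insert m (nu i) (nu (n - i)%N) (permute s d) (permute s x) =
  sym (lastfix true n) (insertion nu i m) (pairs d x).
Proof.
apply: eq_big => [s|s _]; first by rewrite inE.
by rewrite /twist /insertion degs_permute vals_permute degs_pairs vals_pairs.
Qed.

Lemma gamma_hat_PL : A_infinity G mu -> PL_infinity G (gamma_hat G mu).
Proof.
rewrite gamma_hat_averaged => -[mu_deg mu_rel]; split.
- exact: averaged_deg.
- move=> n s d x dx; have Gz := homogeneous_pairsP dx.
  rewrite -koszul_fix_last -[x in LHS](vals_pairs d) averagedE //.
  have /(congr1 (@^~ (pairs d x))) E :=
    twist_sym (fun y => mu (vals y)) (fix_last_lastfix false s).
  rewrite -[LHS]E /twist degs_pairs; congr (_ *: _).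
  have -> : permute (fix_last s) x = vals (permute (fix_last s) (pairs d x)).
    by rewrite vals_permute vals_pairs.
  by rewrite averagedE //; apply: homogeneous_permute.
move=> n d x dx; have Gz := homogeneous_pairsP dx.
under eq_bigr do under eq_bigr do rewrite sum_fix_last_insertion.
under eq_bigr => i _.
  rewrite -scaler_sumr (sym_insertion_averaged (X := lastfix false) mu_deg i _ Gz) //.
  rewrite !card_lastfix -scaler_nat scalerA mulVf ?fact_pair_neq0 // scale1r -sym_sum.
  over.
(* With the coefficients cancelled, what remains is the stabiliser symmetrization of the
   [A_infinity] relation, which vanishes term by term. *)
rewrite -sym_sum; apply: big1 => s _; rewrite /twist.
by rewrite mu_rel ?scaler0 //; apply: homogeneous_permute.
Qed.

Lemma beta_hat_L : PL_infinity G mu -> L_infinity G (beta_hat G mu).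
Proof.
rewrite (_ : beta_hat G mu = averaged G shuffle1 mu) // => -[mu_deg mu_sym mu_rel]; split.
- exact: averaged_deg.
- move=> n s d x dx; have Gz := homogeneous_pairsP dx.
  have Mtwist (t : 'S_n) (y : n.+1.-tuple (int * V)) : homogeneous_pairs G y ->
      twist (fix_last t) (fun y => mu (vals y)) y = mu (vals y).
    by move=> Gy; rewrite /twist koszul_fix_last vals_permute -mu_sym.
  (* Up to the invertible factor [n!], the shuffle sum is a full symmetrization, and this makes its
     symmetry evident. *)
  have betaE (y : n.+1.-tuple (int * V)) : homogeneous_pairs G y ->
      n`!%:R *: averaged G shuffle1 mu (vals y) = sym (lastfix true n) (fun y => mu (vals y)) y.
    by move=> Gy; rewrite averagedE // scaler_nat (sym_symmetric Mtwist Gy).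
  apply: (scalerI (natr_neq0 (fact_gt0 n))).
  rewrite scalerA mulrC -scalerA -[x in LHS](vals_pairs d) betaE //.
  have -> : permute s x = vals (permute s (pairs d x)) by rewrite vals_permute vals_pairs.
  rewrite betaE; last exact: homogeneous_permute.
  have sfull : s \in lastfix true n by rewrite inE.
  by rewrite -[LHS](congr1 (@^~ _) (twist_sym _ sfull)) /twist degs_pairs.
move=> n d x dx; have Gz := homogeneous_pairsP dx.
under eq_bigr do under eq_bigr do rewrite sum_insertion.
under eq_bigr => i _.
  rewrite -scaler_sumr (sym_insertion_averaged (X := shuffle1) (e := true) mu_deg i _ Gz); last first.
    by move=> k; apply/fintype.subsetP => s _; rewrite inE.
  rewrite !card_shuffle1 -scaler_nat scalerA (_ : _ * _ = (i`! * (n - i)`!)%:R^-1); last first.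
    rewrite !factS mulnACA [X in X%:R^-1]mulnC natrM invfM -mulrA mulVf ?mulr1 //.
    by rewrite natr_neq0.
  over.
(* Multiplying by [n!] turns each full symmetrization into the full symmetrization of a stabiliser
   symmetrization, the form in which the [PL_infinity] relation appears inside. *)
apply: (scalerI (natr_neq0 (fact_gt0 n))); rewrite scaler0 scaler_sumr.
transitivity (sym (lastfix true n) (fun z => \sum_(i < n.+1) \sum_(m < i.+1)
   (i`! * (n - i)`!)%:R^-1 *: sym (lastfix false n) (insertion (@mu) i m) z) (pairs d x)).
  rewrite sym_sum; apply: eq_bigr => i _; rewrite sym_sum scalerA mulrC -scalerA scaler_sumr scaler_sumr.
  apply: eq_bigr => m _; rewrite scaler_nat -sym_full_stab.
  by rewrite /sym scaler_sumr; apply: eq_bigr => s _; rewrite /twist !scalerA mulrC.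
(* Each term is a sign times the [PL_infinity] relation at the permuted arguments [y]. *)
apply: big1 => s _; rewrite /twist; set y := permute s _.
have Gy : homogeneous_pairs G y by apply: homogeneous_permute.
have := mu_rel n _ _ Gy.
under eq_bigr do under eq_bigr do rewrite sum_fix_last_insertion.
rewrite (_ : pairs (degs y) (vals y) = y); first by move=> ->; rewrite scaler0.
by apply: eq_from_tnth => k; rewrite !tnth_mktuple -surjective_pairing.
Qed.
End Main.

Theorem theorem4p2 (K : fieldType) (char0 : [pchar K] =i pred0)
    (V : lmodType K) (G : grading V) :
  (forall mu : operations V,
     A_infinity G mu -> PL_infinity G (gamma_hat G mu)) /\
  (forall mu : operations V,
     PL_infinity G mu -> L_infinity G (beta_hat G mu)).
Proof.
by split=> mu; [apply: gamma_hat_PL|apply: beta_hat_L].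
Qed.
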